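(* Let $n \ge 1$ and let $f:\{-1,+1\}^n\to\{-1,+1\}$ be any Boolean function with total influence $I = I(f)$. Then: (i) $2^{-I} \le \mu(f) \le 2^{-I/2}$; (ii) $\displaystyle \log_2 \mu(f) \ge -\frac{I}{1 + I/n}$.
   Context: For a Boolean function $f:\{-1,+1\}^n\to\{-1,+1\}$, the influence of coordinate $\ell\in\{1,\dots,n\}$ is $\mathrm{Inf}_\ell(f) = \Pr_x[f(x)\ne f(x^{\oplus \ell})]$, where $x$ is uniform on $\{-1,+1\}^n$ and $x^{\oplus\ell}$ is $x$ with coordinate $\ell$ negated. The total influence is $I(f) = \sum_{\ell=1}^n \mathrm{Inf}_\ell(f)$. The BBT contraction invariant is $\mu(f) = \prod_{\ell=1}^n 2^{-\mathrm{Inf}_\ell(f)/(1+\mathrm{Inf}_\ell(f))}$, equivalently $\log_2\mu(f) = -\sum_{\ell=1}^n \frac{\mathrm{Inf}_\ell(f)}{1+\mathrm{Inf}_\ell(f)}$. *)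

(* Defs.v *)
From HB Require Import structures.
From mathcomp Require Import all_boot all_order all_algebra.
From mathcomp Require Import reals exp.

Set Implicit Arguments.
Unset Strict Implicit.
Unset Printing Implicit Defensive.

Import Order.TTheory GRing.Theory Num.Theory.
Local Open Scope ring_scope.

(* The finite type {-1, +1}, as a subtype of int. *)
Definition pm1 : finType := seq_sub [:: -1; 1 : int].

Lemma pm1_opp_subproof (s : pm1) : - ssval s \in [:: -1; 1 : int].
Proof. by case: s => x /=; rewrite !inE => /orP[] /eqP ->. Qed.

Definition pm1_opp (s : pm1) : pm1 := SeqSub (pm1_opp_subproof s).

Definition cube (n : nat) : finType := {ffun 'I_n -> pm1}.

Definition flip (n : nat) (l : 'I_n) (x : cube n) : cube n :=
  [ffun i => if i == l then pm1_opp (x i) else x i].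

(* Probability of the event P under the uniform distribution on T. *)
Definition Pr_unif (R : realType) (T : finType) (P : pred T) : R :=
  #|[set x | P x]|%:R / #|T|%:R.

Definition Inf (R : realType) (n : nat) (f : cube n -> pm1) (l : 'I_n) : R :=
  Pr_unif R [pred x | f x != f (flip l x)].

Definition total_influence (R : realType) (n : nat) (f : cube n -> pm1) : R :=
  \sum_(l < n) Inf R f l.

Definition bbt_mu (R : realType) (n : nat) (f : cube n -> pm1) : R :=
  \prod_(l < n) 2 `^ (- (Inf R f l / (1 + Inf R f l))).

Definition log2 (R : realType) (x : R) : R := ln x / ln 2.

(* Main.v *)
(** Each exponent satisfies t/2 <= t/(1+t) <= t for an influence t in [0, 1],
    and summing over the coordinates gives (i).  For (ii), t/(1+t) is concave,
    so it lies below its tangent line at the mean influence I/n; the linear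
    terms cancel in the sum (Jensen). *)
Require Import Defs.
From HB Require Import structures.
From mathcomp Require Import all_boot all_order all_algebra.
From mathcomp Require Import reals exp.
From mathcomp Require Import ring lra.

Import Order.TTheory GRing.Theory Num.Theory.
Local Open Scope ring_scope.

Lemma Pr_unif_ge0 (R : realType) (T : finType) (P : pred T) :
  0 <= Pr_unif R P.
Proof. by rewrite divr_ge0. Qed.

Lemma Pr_unif_le1 (R : realType) (T : finType) (P : pred T) :
  Pr_unif R P <= 1.
Proof.
(* For empty [T] the quotient is 0, because the inverse of 0 is 0 by convention. *)
rewrite /Pr_unif; have [->|T_gt0] := posnP #|T|; first by rewrite invr0 mulr0.
by rewrite ler_pdivrMr ?ltr0n // mul1r ler_nat max_card.
Qed.

Lemma bbt_muE (R : realType) (n : nat) (f : cube n -> pm1) :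
  bbt_mu R f = 2 `^ (- \sum_(l < n) Inf R f l / (1 + Inf R f l)).
Proof.
rewrite -sumrN /bbt_mu; apply/esym.
apply: (big_morph (fun x : R => 2 `^ x)); last by rewrite powRr0.
(* Splitting the power at x + y = 0 requires a nonzero base, here 2. *)
by move=> x y; rewrite powRD // pnatr_eq0 implybT.
Qed.

Lemma log2_powR (R : realType) (x : R) : log2 (2 `^ x) = x.
Proof. by rewrite /log2 ln_powR mulfK // gt_eqF // ln_gt0 // ltr1n. Qed.

Lemma div1D_le (R : realFieldType) (t : R) : 0 <= t -> t / (1 + t) <= t.
Proof. by move=> t0; rewrite ler_pdivrMr; nra. Qed.

(** On [0, 1] the denominator 1 + t is at most 2. *)
Lemma half_le_div1D (R : realFieldType) (t : R) :
  0 <= t <= 1 -> t / 2 <= t / (1 + t).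
Proof. by move=> /andP[t0 t1]; rewrite ler_pdivlMr; nra. Qed.

(** The slope 1/(1+m)^2 is the derivative of t/(1+t) at m, so the right-hand side is the tangent
    line there. *)
Lemma div1D_le_tangent (R : realFieldType) (m t : R) : 0 <= m -> 0 <= t ->
  t / (1 + t) <= m / (1 + m) + (t - m) / (1 + m) ^+ 2.
Proof.
move=> m0 t0; rewrite -subr_ge0.
(* The gap to the tangent is a square over a positive denominator. *)
have -> : m / (1 + m) + (t - m) / (1 + m) ^+ 2 - t / (1 + t)
          = (t - m) ^+ 2 / ((1 + m) ^+ 2 * (1 + t)).
  by field; apply/andP; split; apply: lt0r_neq0; lra.
by rewrite divr_ge0 ?sqr_ge0 // mulr_ge0 ?sqr_ge0 // addr_ge0.
Qed.

Lemma sum_div1D_le (R : realFieldType) (n : nat) (t : 'I_n -> R) :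
  (0 < n)%N -> (forall l, 0 <= t l) ->
  \sum_(l < n) t l / (1 + t l)
    <= (\sum_(l < n) t l) / (1 + (\sum_(l < n) t l) / n%:R).
Proof.
move=> n_gt0 t_ge0; set s := \sum_(l < n) t l; set m := s / n%:R.
have n_neq0 : n%:R != 0 :> R by rewrite pnatr_eq0 -lt0n.
have m_ge0 : 0 <= m by rewrite divr_ge0 // sumr_ge0.
have sE : s = m *+ n by rewrite -mulr_natr divfK.
have tangent l := @div1D_le_tangent _ m (t l) m_ge0 (t_ge0 l).
apply: (le_trans (ler_sum _ (fun l _ => tangent l))).
(* Since s = n m, the deviations [t l - m] sum to zero, and the n copies of m/(1+m) add up to
   s/(1+m). *)
rewrite big_split /= -[X in _ + X <= _]mulr_suml sumrB !sumr_const.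
by rewrite card_ord -/s -sE subrr mul0r addr0 -mulrnAl -sE.
Qed.

Theorem theorem3p6 (R : realType) (n : nat) (hn : (1 <= n)%N)
    (f : cube n -> pm1) :
  (2 `^ (- total_influence R f) <= bbt_mu R f /\
   bbt_mu R f <= 2 `^ (- (total_influence R f / 2))) /\
  log2 (bbt_mu R f) >=
    - (total_influence R f / (1 + total_influence R f / n%:R)).
Proof.
have Inf_ge0 l : 0 <= Inf R f l by exact: Pr_unif_ge0.
have Inf_le1 l : Inf R f l <= 1 by exact: Pr_unif_le1.
rewrite bbt_muE log2_powR; split; [split|].
- by rewrite ler_powR ?ler1n // lerN2 ler_sum // => l _; exact: div1D_le.
- rewrite ler_powR ?ler1n // lerN2 mulr_suml ler_sum // => l _.
  by apply: half_le_div1D; rewrite Inf_ge0 Inf_le1.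
- by rewrite lerN2; exact: sum_div1D_le.
Qed.
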